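(* For every matroid $M$ and every $t\in\mathbb{N}$, $bw(M^t)\leq t(bw(M)-1)+1$.
   Context: A cyclic flat of a matroid $M$ is a flat $F$ such that $M|F$ has no coloops; $\mathcal{Z}(M)$ denotes the set of cyclic flats, and a matroid is determined by its cyclic flats and their ranks. The $t$-expansion: fix $t\in\mathbb{N}$; for each $e\in E(M)$ let $S_e$ be a $t$-element set with $e\in S_e$, the sets $S_e$ pairwise disjoint; for $X\subseteq E(M)$ let $S_X=\bigcup_{e\in X}S_e$. The $t$-expansion $M^t$ is the matroid on $S_{E(M)}$ whose cyclic flats are exactly the sets $S_A$ with $A\in\mathcal{Z}(M)$, with $r_{M^t}(S_A)=t\cdot r_M(A)$. For $X\subseteq E(M)$ let $\overline{X}=E(M)-X$ and $\lambda_M(X)=r(X)+r(\overline{X})-r(M)$. A branch-decomposition of $M$ is a tree $T$ whose non-leaf vertices all have degree $3$, with an injection from $E(M)$ into the leaves of $T$; each edge $e$ displays the partition $(X,\overline{X})$ given by the labels on leaves of the two components of $T-e$, and has width $\lambda_M(X)+1$. The width of a branch-decomposition is its maximum edge width, and $bw(M)$ is the minimum width over all branch-decompositions of $M$. *)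

(* Defs.v *)
From mathcomp Require Import all_boot.
From mathcomp Require Import boolp.
From mathcomp Require Import zify.
Set Implicit Arguments.
Unset Strict Implicit.
Unset Printing Implicit Defensive.

(* A matroid whose ground set E(M) is the finite type T, presented by its
   rank function. *)
Record matroid (T : finType) := Matroid {
  rank : {set T} -> nat;
  rank_le_card : forall X, rank X <= #|X|;
  rank_mono : forall X Y : {set T}, X \subset Y -> rank X <= rank Y;
  rank_submod : forall X Y,
    rank (X :|: Y) + rank (X :&: Y) <= rank X + rank Y
}.

Section MatroidDefs.
Variables (T : finType) (M : matroid T).
Implicit Types (X F B : {set T}) (e : T).

Definition flat F : Prop := forall e, e \notin F -> rank M F < rank M (e |: F).

(* B is a basis of the restriction M|F *)
Definition basis_restr F B : Prop :=
  [/\ B \subset F, rank M B = #|B| & rank M B = rank M F].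

(* e is a coloop of the restriction M|F: it lies in every basis of M|F *)
Definition coloop_restr F e : Prop :=
  e \in F /\ forall B, basis_restr F B -> e \in B.

Definition cyclic_flat F : Prop :=
  flat F /\ forall e, ~ coloop_restr F e.

(* The subtraction is never truncated, by submodularity. *)
Definition lambda X : nat := rank M X + rank M (~: X) - rank M setT.

End MatroidDefs.

(* S_X, for a family S of subsets of T' indexed by T *)
Definition blowup (T T' : finType) (S : T -> {set T'}) (X : {set T}) : {set T'} :=
  \bigcup_(e in X) S e.

(* Mt is the t-expansion of M with respect to the family (S_e). Its ground set
   T' is the union of the S_e. The convention e \in S_e, which only serves to
   view E(M) as a subset of E(Mt), is dropped. *)
Record is_expansion (T T' : finType) (t : nat) (S : T -> {set T'})
    (M : matroid T) (Mt : matroid T') : Prop := IsExpansion {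
  exp_card : forall e, #|S e| = t;
  exp_disj : forall e f, e != f -> [disjoint S e & S f];
  exp_cover : blowup S setT = setT;
  exp_cyclic_flat : forall F,
    cyclic_flat Mt F <-> exists2 A, cyclic_flat M A & F = blowup S A;
  exp_rank : forall A, cyclic_flat M A -> rank Mt (blowup S A) = t * rank M A
}.

Section Graphs.
Variables (V : finType) (adj : rel V).

Definition is_tree : Prop :=
  [/\ symmetric adj, irreflexive adj, 0 < #|V|,
      forall x y, connect adj x y
    & forall c : seq V, ucycle adj c -> size c <= 2].

Definition degree (v : V) : nat := #|[set w | adj v w]|.

Definition leaf (v : V) : bool := degree v == 1.

Definition del_edge (u v : V) : rel V :=
  [rel x y | [&& adj x y, (x, y) != (u, v) & (x, y) != (v, u)]].

End Graphs.

(* Leaves have degree exactly 1, so the one-vertex tree is excluded and every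
   branch-decomposition has at least one edge. Leaves may be unlabelled. *)
Record branch_decomposition (T : finType) := BranchDecomposition {
  bd_vertex : finType;
  bd_adj : rel bd_vertex;
  bd_tree : is_tree bd_adj;
  bd_cubic : forall v, ~~ leaf bd_adj v -> degree bd_adj v = 3;
  bd_label : T -> bd_vertex;
  bd_label_inj : injective bd_label;
  bd_label_leaf : forall e, leaf bd_adj (bd_label e)
}.

(* The labels in the component of u after deleting the edge uv; the other side
   of the displayed partition is displayed D v u. *)
Definition displayed (T : finType) (D : branch_decomposition T)
    (u v : bd_vertex D) : {set T} :=
  [set e | connect (del_edge (@bd_adj T D) u v) u (bd_label D e)].

Definition bd_width (T : finType) (M : matroid T) (D : branch_decomposition T)
    : nat :=
  \max_(p : bd_vertex D * bd_vertex D | bd_adj p.1 p.2)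
     (lambda M (displayed p.1 p.2) + 1).

(* Every finite ground set has a branch-decomposition: label the even vertices
   of the cubic caterpillar on 0, ..., 2n+1 in which 1 is joined to 0, and both
   2k and 2k+1 are joined to 2k-1 for 1 <= k <= n. *)
Section Caterpillar.
Variable n : nat.

Definition cat_parent (x : nat) : nat := (x./2).*2.-1.

Definition cat_adj : rel 'I_(n.*2.+2) :=
  fun x y => ((x < y) && (cat_parent y == x)) || ((y < x) && (cat_parent x == y)).

Lemma cat_tree : is_tree cat_adj.
Proof.
have sym : symmetric cat_adj by move=> x y; rewrite /cat_adj /= orbC.
split=> //.
- by move=> x; rewrite /cat_adj /= ltnn.
- by rewrite card_ord.
- have to0 : forall k (x : 'I_(n.*2.+2)), x <= k -> connect cat_adj x ord0.
    elim=> [|k IH] x xk.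
      by have -> : x = ord0 by apply: val_inj => /=; lia.
    case: (posnP x) => [x0|xpos].
      by have -> : x = ord0 by apply: val_inj.
    have ltp : cat_parent x < x by rewrite /cat_parent; lia.
    have ltn' : cat_parent x < n.*2.+2 by apply: ltn_trans ltp _.
    apply: (@connect_trans _ _ (Ordinal ltn')).
      by apply: connect1; rewrite /cat_adj /= ltp eqxx orbT.
    by apply: IH => /=; lia.
  move=> x y; apply: (@connect_trans _ _ ord0); first exact: (to0 x).
  by rewrite (sym_connect_sym sym); exact: (to0 y).
- move=> c /andP[cyc uc]; rewrite leqNgt; apply/negP => sc.
  have [x0 x0c] : exists x, x \in c.
    by case: c sc {cyc uc} => // a c _; exists a; rewrite mem_head.
  have [m mc maxm] : exists2 m, m \in c & forall z, z \in c -> z <= m.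
    case: (arg_maxnP (P := [pred z | z \in c]) (@nat_of_ord _) x0c) => m mc H.
    by exists m => // z /H.
  have [i c' Ec] := rot_to mc.
  have cyc' : cycle cat_adj (m :: c') by rewrite -Ec rot_cycle.
  have uc' : uniq (m :: c') by rewrite -Ec rot_uniq.
  have sc' : 2 < size (m :: c') by rewrite -Ec size_rot.
  have max' z : z \in m :: c' -> z <= m by rewrite -Ec mem_rot; apply: maxm.
  case: c' cyc' uc' sc' max' {Ec} => [|x c'] //=.
  case/lastP: c' => [|c' y] //= /andP[mx]; rewrite -cats1 -cats1 -catA cat_path.
  rewrite /= => /and3P[_ _ /andP[ym _]].
  rewrite !inE !mem_cat !inE => /andP[_ /andP[xny _]] _ max'.
  have xm := max' x; have ym' := max' y; move: xm ym' mx ym.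
  rewrite !(inE, mem_cat) !eqxx !orbT => /(_ isT) xm /(_ isT) ym'.
  rewrite /cat_adj !ltnNge xm ym' /= orbF.
  move=> /andP[_ /eqP xE] /andP[_ /eqP yE].
  by case/negP: xny; apply/orP; right; apply/eqP/val_inj; rewrite /= -xE -yE.
Qed.

Lemma cat_leaf (x : 'I_(n.*2.+2)) : ~~ odd x -> leaf cat_adj x.
Proof.
move=> ox; rewrite /leaf /degree; apply/cards1P.
case: (posnP x) => [x0|xpos].
  have l1 : 1 < n.*2.+2 by [].
  exists (Ordinal l1); apply/setP=> w; rewrite !inE -val_eqE /cat_adj /cat_parent /=.
  by rewrite x0; lia.
have l1 : cat_parent x < n.*2.+2 by have := ltn_ord x; rewrite /cat_parent; lia.
exists (Ordinal l1); apply/setP=> w; rewrite !inE -val_eqE /cat_adj /cat_parent /=.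
lia.
Qed.

Lemma cat_cubic (x : 'I_(n.*2.+2)) : ~~ leaf cat_adj x -> degree cat_adj x = 3.
Proof.
move=> nl; have ox : odd x by apply: contraNT nl; apply: cat_leaf.
have xn := ltn_ord x.
have xlt : x < n.*2.+1.
  rewrite ltnNge; apply/negP => xge; case/negP: nl; apply/cards1P.
  have l1 : cat_parent x < n.*2.+2 by rewrite /cat_parent; lia.
  exists (Ordinal l1); apply/setP=> w; rewrite !inE -val_eqE /cat_adj /cat_parent /=.
  by have := ltn_ord w; lia.
have l1 : cat_parent x < n.*2.+2 by rewrite /cat_parent; lia.
have l2 : x.+1 < n.*2.+2 by lia.
have l3 : x.+2 < n.*2.+2 by lia.
rewrite /degree.
have -> : [set w | cat_adj x w] = [set Ordinal l1; Ordinal l2; Ordinal l3].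
  apply/setP=> w; rewrite !inE -!val_eqE /cat_adj /cat_parent /=.
  by have := ltn_ord w; lia.
rewrite setUC cardsU1 cards2 !inE -!val_eqE /= /cat_parent; lia.
Qed.
End Caterpillar.

Lemma cat_label_subproof (T : finType) (e : T) :
  (enum_rank e).*2 < #|T|.*2.+2.
Proof. by rewrite ltnS leqW // leq_double ltnW. Qed.

Definition cat_label (T : finType) (e : T) : 'I_(#|T|.*2.+2) :=
  Ordinal (cat_label_subproof e).

Lemma cat_label_inj (T : finType) : injective (@cat_label T).
Proof.
move=> e f [] /eqP; rewrite -!muln2 eqn_pmul2r // => /eqP H.
by apply: enum_rank_inj; apply: val_inj.
Qed.

Lemma cat_label_leaf (T : finType) (e : T) : leaf (@cat_adj #|T|) (cat_label e).
Proof. by apply: cat_leaf; rewrite /= odd_double. Qed.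

Definition caterpillar (T : finType) : branch_decomposition T :=
  BranchDecomposition (cat_tree #|T|) (@cat_cubic #|T|)
    (@cat_label_inj T) (@cat_label_leaf T).

Lemma bd_width_exists (T : finType) (M : matroid T) :
  exists k, `[< exists D : branch_decomposition T, bd_width M D = k >].
Proof. by exists (bd_width M (caterpillar T)); apply/asboolP; exists (caterpillar T). Qed.

Definition bw (T : finType) (M : matroid T) : nat := ex_minn (bd_width_exists M).

Lemma bd_width_gt0 (T : finType) (M : matroid T) D : 0 < bd_width M D.
Proof.
case: (bd_tree D) => _ _ /card_gt0P[v _] _ _.
have dv : 0 < degree (@bd_adj T D) v.
  case: (boolP (leaf (@bd_adj T D) v)) => [/eqP -> //|/bd_cubic -> //].
case/card_gt0P: dv => w; rewrite inE => vw.
apply: (@leq_trans (lambda M (displayed v w) + 1)); first by rewrite addn1.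
exact: (@leq_bigmax_cond _ (fun p : bd_vertex D * bd_vertex D => bd_adj p.1 p.2)
  (fun p => lambda M (displayed p.1 p.2) + 1) (v, w)).
Qed.

Lemma bw_gt0 (T : finType) (M : matroid T) : 0 < bw M.
Proof. by rewrite /bw; case: ex_minnP => k /asboolP[D <-] _; apply: bd_width_gt0. Qed.

Section Bases.
Variables (T : finType) (M : matroid T).
Implicit Types (X F B : {set T}) (e : T).

Lemma rank0 : rank M set0 = 0.
Proof. by apply/eqP; rewrite -leqn0; have := rank_le_card M set0; rewrite cards0. Qed.

Lemma rankU_le X Y : rank M (X :|: Y) <= rank M X + #|Y|.
Proof.
have := rank_submod M X Y; have := rank_le_card M Y; lia.
Qed.

Lemma basis_exists F : exists B, basis_restr M F B.
Proof.
have H0 : rank M set0 == #|(set0 : {set T})| by rewrite rank0 cards0.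
pose P := [pred B : {set T} | (B \subset F) && (rank M B == #|B|)].
have P0 : P set0 by rewrite /P /= sub0set H0.
case: (arg_maxnP (fun B : {set T} => #|B|) P0) => B /andP[sBF /eqP rB] maxB.
exists B; split=> //.
have step e : e \in F -> rank M (e |: B) = rank M B.
  move=> eF; case: (boolP (e \in B)) => [eB|eB].
    by congr rank; apply/setUidPr; rewrite sub1set.
  have up : rank M (e |: B) <= #|B|.+1.
    by have := rank_le_card M (e |: B); rewrite cardsU1 eB.
  have lo : rank M B <= rank M (e |: B) by apply: rank_mono; apply: subsetUr.
  apply/eqP; rewrite eqn_leq lo andbT leqNgt rB; apply/negP => lt.
  have /maxB : P (e |: B).
    by rewrite /P /= subUset sub1set eF sBF cardsU1 eB /= add1n eqn_leq up lt.
  by rewrite cardsU1 eB; lia.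
have all_in k X : #|X| = k -> X \subset F -> rank M (X :|: B) = rank M B.
  elim: k X => [|k IH] X.
    by move/eqP; rewrite cards_eq0 => /eqP -> _; rewrite set0U.
  move=> cX sXF; have /card_gt0P[e eX] : 0 < #|X| by rewrite cX.
  have eF := subsetP sXF _ eX.
  have {}IH : rank M ((X :\ e) :|: B) = rank M B.
    apply: IH; first by have := cardsD1 e X; rewrite eX; lia.
    by apply: subset_trans sXF; apply: subsetDl.
  have := rank_submod M ((X :\ e) :|: B) (e |: B); rewrite IH (step _ eF).
  have -> : (X :\ e) :|: B :|: (e |: B) = X :|: B.
    apply/setP=> x; rewrite !inE; case: eqP => [->|_]; first by rewrite eX orbT.
    by case: (x \in X); case: (x \in B).
  have : rank M B <= rank M (((X :\ e) :|: B) :&: (e |: B)).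
    by apply: rank_mono; rewrite subsetI !subsetUr.
  have : rank M B <= rank M (X :|: B) by apply: rank_mono; apply: subsetUr.
  by lia.
by rewrite -(all_in _ F erefl (subxx _)) (setUidPl sBF).
Qed.

Lemma coloop_restrP F e :
  coloop_restr M F e <-> e \in F /\ rank M (F :\ e) < rank M F.
Proof.
split=> [[eF H]|[eF H]]; split=> //.
  rewrite ltnNge; apply/negP => le; have [B [sB rB rBF]] := basis_exists (F :\ e).
  have /H : basis_restr M F B.
    split=> //; first by apply: subset_trans sB _; apply: subsetDl.
    by rewrite rBF; apply/eqP; rewrite eqn_leq le rank_mono ?subsetDl.
  by move/(subsetP sB); rewrite !inE eqxx.
move=> B [sB rB rBF]; apply: contraLR H => eB.
by rewrite -leqNgt -rBF; apply: rank_mono; rewrite subsetD1 sB eB.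
Qed.

Lemma cyclic_flat_exists : exists A, cyclic_flat M A.
Proof.
have P0 : rank M set0 == 0 by rewrite rank0.
case: (arg_maxnP (P := [pred A : {set T} | rank M A == 0]) (fun A : {set T} => #|A|) P0)
  => A /= /eqP rA maxA.
exists A; split=> [e eA|e /coloop_restrP[_]]; last by rewrite rA.
rewrite rA lt0n; apply/negP => /maxA; rewrite cardsU1 eA /=; lia.
Qed.
End Bases.

(* The expansion exists for every M, t and every choice of the sets S_e. *)
Section ExpansionExists.
Variables (T T' : finType) (t : nat) (S : T -> {set T'}) (M : matroid T).
Hypothesis S_card : forall e, #|S e| = t.
Hypothesis S_disj : forall e f, e != f -> [disjoint S e & S f].
Hypothesis S_cover : blowup S setT = setT.

Lemma blowup_cover x : exists e, x \in S e.
Proof.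
have : x \in blowup S setT by rewrite S_cover inE.
by case/bigcupP => e _ xe; exists e.
Qed.

Lemma mem_blowup x e X : x \in S e -> (x \in blowup S X) = (e \in X).
Proof.
move=> xe; apply/bigcupP/idP => [[f fX xf]|eX]; last by exists e.
case: (eqVneq e f) => [->//|/S_disj /disjointFr /(_ xe)].
by rewrite xf.
Qed.

Lemma blowup0 : blowup S set0 = set0.
Proof. exact: big_set0. Qed.

Lemma blowup1 e : blowup S [set e] = S e.
Proof. exact: big_set1. Qed.

Lemma blowupU X Y : blowup S (X :|: Y) = blowup S X :|: blowup S Y.
Proof.
apply/setP=> x; have [e xe] := blowup_cover x.
by rewrite in_setU !(mem_blowup _ xe) inE.
Qed.

Lemma blowupD X Y : blowup S (X :\: Y) = blowup S X :\: blowup S Y.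
Proof.
apply/setP=> x; have [e xe] := blowup_cover x.
by rewrite in_setD !(mem_blowup _ xe) inE.
Qed.

Lemma card_blowup X : #|blowup S X| = t * #|X|.
Proof.
elim: {X}#|X| {-2}X (erefl #|X|) => [|k IH] X.
  by move/eqP; rewrite cards_eq0 => /eqP ->; rewrite blowup0 !cards0 muln0.
move=> cX; have /card_gt0P[e eX] : 0 < #|X| by rewrite cX.
have cX' : #|X :\ e| = k by have := cardsD1 e X; rewrite eX; lia.
rewrite -(setD1K eX) blowupU blowup1 cardsU IH // S_card setD1K // cX cX'.
have -> : S e :&: blowup S (X :\ e) = set0.
  apply/setP=> x; rewrite !inE; apply/negP => /andP[xe].
  by rewrite (mem_blowup _ xe) !inE eqxx.
by rewrite cards0; lia.
Qed.

Definition ecost (Y : {set T'}) (X : {set T}) : nat :=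
  t * rank M X + #|Y :\: blowup S X|.

Definition erank (Y : {set T'}) : nat :=
  ecost Y [arg min_(X < set0) ecost Y X].

Lemma erank_le Y X : erank Y <= ecost Y X.
Proof. by rewrite /erank; case: arg_minnP => // X0 _ /(_ X isT). Qed.

Lemma erank_ex Y : exists X, erank Y = ecost Y X.
Proof. by eexists. Qed.

Lemma erank_le_card Y : erank Y <= #|Y|.
Proof. by have := erank_le Y set0; rewrite /ecost rank0 blowup0 setD0 muln0. Qed.

Lemma erank_mono (X Y : {set T'}) : X \subset Y -> erank X <= erank Y.
Proof.
move=> sXY; have [A ->] := erank_ex Y; apply: leq_trans (erank_le X A) _.
by rewrite leq_add2l subset_leq_card // setSD.
Qed.

Lemma erank_submod X Y : erank (X :|: Y) + erank (X :&: Y) <= erank X + erank Y.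
Proof.
have [A ->] := erank_ex X; have [B ->] := erank_ex Y.
have := erank_le (X :|: Y) (A :|: B); have := erank_le (X :&: Y) (A :&: B).
rewrite /ecost.
have := leq_mul (leqnn t) (rank_submod M A B).
suff: #|(X :|: Y) :\: blowup S (A :|: B)| + #|(X :&: Y) :\: blowup S (A :&: B)|
  <= #|X :\: blowup S A| + #|Y :\: blowup S B| by rewrite !mulnDr; lia.
rewrite -(cardsUI (X :\: _)).
apply: (@leq_trans (#|((X :|: Y) :\: blowup S (A :|: B)) :|: ((X :&: Y) :\: blowup S (A :&: B))|
  + #|((X :|: Y) :\: blowup S (A :|: B)) :&: ((X :&: Y) :\: blowup S (A :&: B))|)).
  by rewrite cardsUI.
by apply: leq_add; apply: subset_leq_card; apply/subsetP => x; have [e xe] := blowup_cover x;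
  rewrite !inE !(mem_blowup _ xe) !inE; case: (x \in X); case: (x \in Y);
  case: (e \in A); case: (e \in B).
Qed.

Definition expansion : matroid T' :=
  Matroid erank_le_card erank_mono erank_submod.

Lemma rank_expansion A : rank expansion (blowup S A) = t * rank M A.
Proof.
apply/eqP; rewrite eqn_leq /=; apply/andP; split.
  by have := erank_le (blowup S A) A; rewrite /ecost setDv cards0 addn0.
have [X ->] := erank_ex (blowup S A).
rewrite /ecost -blowupD card_blowup -mulnDr leq_mul2l; apply/orP; right.
apply: leq_trans (rankU_le M X (A :\: X)); apply: rank_mono.
by apply/subsetP=> x xA; rewrite !inE xA; case: (x \in X).
Qed.

Lemma expansionP : is_expansion t S M expansion.
Proof.
split=> // [F|A _]; last exact: rank_expansion.
split=> [[fF cF]|[A [fA cA] ->]].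
  have [X EX] := erank_ex F.
  have FX : F \subset blowup S X.
    rewrite -setD_eq0; apply/set0Pn => -[y yF].
    case: (cF y); apply/coloop_restrP; move: (yF); rewrite inE => /andP[yX ->]; split=> //=.
    apply: leq_ltn_trans (erank_le _ X) _; rewrite EX /ecost ltn_add2l.
    apply: proper_card; apply: (@sub_proper_trans _ _ (pred_of_set ((F :\: blowup S X) :\ y))).
      by apply/subsetP=> z; rewrite !inE; case: (z \in F); case: (z == y); case: (z \in blowup S X).
    exact: properD1.
  have EF : F = blowup S X.
    apply/eqP; rewrite eqEsubset FX; apply/subsetP=> y yX; apply/negPn/negP => yF.
    have := fF y yF; rewrite /= EX /ecost.
    have -> : F :\: blowup S X = set0 by apply/eqP; rewrite setD_eq0.
    rewrite cards0 addn0 -rank_expansion /= ltnNge => /negP; apply; apply: erank_mono.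
    by rewrite subUset sub1set yX.
  case: (posnP t) => [t0|tpos].
    have [A cA] := cyclic_flat_exists M; exists A => //.
    have B0 Z : blowup S Z = set0 by apply/eqP; rewrite -cards_eq0 card_blowup t0.
    by rewrite EF !B0.
  have Sne e : exists y, y \in S e by apply/card_gt0P; rewrite S_card.
  exists X => //; split=> [e eX|e /coloop_restrP[eX re]].
    rewrite ltnNge; apply/negP => re; have [y ye] := Sne e.
    have := fF y; rewrite EF (mem_blowup _ ye) => /(_ eX); rewrite rank_expansion.
    rewrite ltnNge => /negP; apply.
    apply: (@leq_trans (t * rank M (e |: X))); last by rewrite leq_mul2l re orbT.
    rewrite -rank_expansion; apply: erank_mono.
    by rewrite blowupU blowup1 setSU // sub1set.
  have [y ye] := Sne e; case: (cF y); apply/coloop_restrP.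
  rewrite EF (mem_blowup _ ye); split=> //; rewrite rank_expansion /=.
  apply: leq_ltn_trans (erank_le _ (X :\ e)) _; rewrite /ecost.
  have : #|(blowup S X :\ y) :\: blowup S (X :\ e)| <= #|S e :\ y|.
    apply: subset_leq_card; apply/subsetP=> z; have [f zf] := blowup_cover z.
    rewrite !inE !(mem_blowup _ zf) !inE => /andP[h /andP[-> fX]] /=.
    by move: h; rewrite fX andbT negbK => /eqP <-.
  have := cardsD1 y (S e); rewrite ye S_card.
  have : t * (rank M (X :\ e)).+1 <= t * rank M X by rewrite leq_mul2l re orbT.
  by rewrite mulnS; lia.
split=> [y|y /coloop_restrP[]].
  have [e ye] := blowup_cover y; rewrite (mem_blowup _ ye) => eA.
  have tpos : 0 < t by rewrite -(S_card e); apply/card_gt0P; exists y.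
  rewrite rank_expansion /=; have [X ->] := erank_ex (y |: blowup S A); rewrite /ecost.
  have sub1 : t * #|A :\: X| <= #|(y |: blowup S A) :\: blowup S X|.
    by rewrite -card_blowup blowupD; apply: subset_leq_card; rewrite setSD // subsetUr.
  have [eX|eX] := boolP (e \in X).
    have := fA e eA; have : rank M (e |: A) <= rank M X + #|A :\: X|.
      apply: leq_trans (rankU_le M X _); apply: rank_mono.
      by apply/subsetP=> x; rewrite !inE => /orP[/eqP->|->]; rewrite ?eX //; case: (x \in X).
    move=> h1 h2; have := leq_mul (leqnn t) (leq_trans h2 h1).
    by rewrite mulnS mulnDr; lia.
  have : rank M A <= rank M X + #|A :\: X|.
    apply: leq_trans (rankU_le M X _); apply: rank_mono.
    by apply/subsetP=> x; rewrite !inE => ->; case: (x \in X).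
  move=> h; have := leq_mul (leqnn t) h; rewrite mulnDr.
  suff : t * #|A :\: X| < #|(y |: blowup S A) :\: blowup S X| by lia.
  rewrite -card_blowup blowupD; apply: proper_card; apply/properP.
  split; first by rewrite setSD // subsetUr.
  by exists y; rewrite !inE !(mem_blowup _ ye) ?(negPf eA) ?eqxx ?eX ?andbF.
have [e ye] := blowup_cover y; rewrite (mem_blowup _ ye) => eA.
have tpos : 0 < t by rewrite -(S_card e); apply/card_gt0P; exists y.
have rAe : rank M A <= rank M (A :\ e).
  by rewrite leqNgt; apply/negP => lt; apply: (cA e); apply/coloop_restrP.
rewrite rank_expansion /=; have [X ->] := erank_ex (blowup S A :\ y); rewrite /ecost.
rewrite ltnNge => /negP; apply.
have [eX|eX] := boolP (e \in X).
  have -> : (blowup S A :\ y) :\: blowup S X = blowup S (A :\: X).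
    apply/setP=> z; have [f zf] := blowup_cover z; rewrite !inE !(mem_blowup _ zf) !inE.
    case: (eqVneq z y) => //= zy; subst z.
    by rewrite -(mem_blowup X zf) (mem_blowup X ye) eX.
  rewrite card_blowup -mulnDr leq_mul2l; apply/orP; right.
  apply: leq_trans (rankU_le M X _); apply: rank_mono.
  by apply/subsetP=> x; rewrite !inE => ->; case: (x \in X).
have h1 : rank M A <= rank M X + #|(A :\: X) :\ e|.
  apply: leq_trans rAe _; apply: leq_trans (rankU_le M X _); apply: rank_mono.
  by apply/subsetP=> x; rewrite !inE => /andP[-> ->]; case: (x \in X).
apply: (leq_trans (leq_mul (leqnn t) h1)); rewrite mulnDr leq_add2l -card_blowup.
apply: subset_leq_card; apply/subsetP=> z; have [f zf] := blowup_cover z.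
rewrite !inE !(mem_blowup _ zf) !inE => /and3P[fe -> ->]; rewrite andbT /=.
apply: contraNneq fe => zy; subst z.
by have := mem_blowup [set e] zf; rewrite (mem_blowup _ ye) !inE eqxx => <-.
Qed.

Lemma expansion_exists : exists Mt, is_expansion t S M Mt.
Proof. by exists expansion; apply: expansionP. Qed.
End ExpansionExists.

(* Main.v *)
(* Ranks in a matroid are given by r(X) = min (r(F) + |X - F|) over the cyclic
   flats F, so r(S_A) = t r(A) in the expansion for every A, and lambda(S_A) =
   t lambda(A). Send all of S_e to the leaf labelled e in an optimal
   branch-decomposition of M, and then replace that leaf by a subtree whose
   leaves carry the elements of S_e. The old edges have width t lambda(A) + 1.
   The new ones display subsets X of S_e, for which lambda(X) <= t lambda(e):
   this is |X| <= t if lambda(e) > 0, while e is a loop or a coloop if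
   lambda(e) = 0; and lambda(e) + 1 is the width of the edge at the leaf e. *)
Require Import Defs.
From mathcomp Require Import all_boot.
From mathcomp Require Import boolp zify.
Set Implicit Arguments.
Unset Strict Implicit.
Unset Printing Implicit Defensive.

(** * Ranks computed from cyclic flats *)

Lemma rank_le_setD (T : finType) (M : matroid T) (X F : {set T}) :
  rank M X <= rank M F + #|X :\: F|.
Proof.
apply: leq_trans (rankU_le M F _); apply: rank_mono.
by apply/subsetP=> x xX; rewrite !inE xX andbT orbN.
Qed.

(** Among the sets [F] attaining the minimum of [rank M F + #|X :\: F|], take one of least rank and,
    among those, of largest size. An element that could be added without raising the rank would
    contradict the size. Deleting a coloop lowers the rank and adds at most one to [#|X :\: F|],
    which would contradict the rank. *)
Lemma cyclic_flat_rank (T : finType) (M : matroid T) (X : {set T}) :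
  exists2 F, cyclic_flat M F & rank M X = rank M F + #|X :\: F|.
Proof.
have rle := rank_le_setD M X.
have PX : [pred F | rank M F + #|X :\: F| == rank M X] X.
  by rewrite /= setDv cards0 addn0.
(* The lexicographic choice as a single number: [#|~: F|] stays below the weight [#|T|.+1]. *)
case: (arg_minnP (fun F : {set T} => rank M F * #|T|.+1 + #|~: F|) PX).
set N := #|T| => F /= /eqP EF minF; exists F => //.
have cC (A : {set T}) : #|~: A| <= N by apply: max_card.
split=> [e eF|e /coloop_restrP[eF re]].
  have lo : rank M F <= rank M (e |: F) by apply: rank_mono; apply: subsetUr.
  rewrite ltnNge; apply/negP => hi.
  have Er : rank M (e |: F) = rank M F by apply/eqP; rewrite eqn_leq hi.
  have /minF : rank M (e |: F) + #|X :\: (e |: F)| == rank M X.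
    rewrite eqn_leq rle andbT Er -EF leq_add2l subset_leq_card //.
    by apply: setDS; apply: subsetUr.
  rewrite Er leq_add2l => le; have : #|~: (e |: F)| < #|~: F|.
    by apply: proper_card; rewrite properC; apply: properUr; rewrite sub1set.
  lia.
have cD : #|X :\: (F :\ e)| <= #|X :\: F|.+1.
  have : #|X :\: (F :\ e)| <= #|e |: (X :\: F)|.
    by apply: subset_leq_card; apply/subsetP=> x; rewrite !inE; case: (x == e).
  by rewrite cardsU1; case: (_ \notin _); lia.
have /minF : rank M (F :\ e) + #|X :\: (F :\ e)| == rank M X.
  rewrite eqn_leq rle andbT -EF.
  by apply: leq_trans (leq_add (leqnn _) cD) _; rewrite addnS -addSn leq_add2r.
have := cC (F :\ e); move: (N) re => n; nia.
Qed.

(** * Rank and connectivity in the expansion *)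

Section Expansion.
Variables (T T' : finType) (M : matroid T) (t : nat).
Variables (S : T -> {set T'}) (Mt : matroid T').
Hypothesis hMt : is_expansion t S M Mt.

Let S_card := exp_card hMt.
Let S_disj := exp_disj hMt.
Let S_cover := exp_cover hMt.

(** A cyclic flat attaining the rank in one matroid corresponds to a cyclic flat of the other, and
    [blowup S A :\: blowup S F] has [t * #|A :\: F|] elements. Each inequality uses one direction of
    this correspondence. *)
Lemma rank_blowup A : rank Mt (blowup S A) = t * rank M A.
Proof.
apply/eqP; rewrite eqn_leq; apply/andP; split.
  have [F cF ->] := cyclic_flat_rank M A.
  rewrite mulnDr -(exp_rank hMt cF) -(card_blowup S_card S_disj S_cover).
  rewrite (blowupD S_disj S_cover).
  exact: rank_le_setD.
have [F' cF' ->] := cyclic_flat_rank Mt (blowup S A).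
have [F cF ->] := (exp_cyclic_flat hMt F').1 cF'.
rewrite (exp_rank hMt cF) -(blowupD S_disj S_cover).
rewrite (card_blowup S_card S_disj S_cover) -mulnDr leq_mul2l; apply/orP; right.
exact: rank_le_setD.
Qed.

Lemma blowupC A : blowup S (~: A) = ~: blowup S A.
Proof. by rewrite -!setTD (blowupD S_disj S_cover) S_cover. Qed.

Lemma lambda_blowup A : lambda Mt (blowup S A) = t * lambda M A.
Proof. by rewrite /lambda -blowupC -S_cover !rank_blowup mulnBr mulnDr. Qed.

Lemma lambda_sub_fiber e (X : {set T'}) :
  X \subset S e -> lambda Mt X <= t * lambda M [set e].
Proof.
move=> sX.
have cX : #|X| <= t by rewrite -(S_card e) subset_leq_card.
have rX : rank Mt X <= t := leq_trans (rank_le_card Mt X) cX.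
have rCX : rank Mt (~: X) <= rank Mt setT by apply: rank_mono; apply: subsetT.
case: (posnP (lambda M [set e])) => [l0|lpos]; last first.
  by apply: leq_trans (leq_pmulr t lpos); rewrite /lambda; lia.
have := lambda_blowup [set e]; rewrite blowup1 l0 muln0 /lambda => lS.
have rS : rank Mt (S e) = t * rank M [set e] by rewrite -rank_blowup blowup1.
have r1 : rank M [set e] <= 1 by rewrite -(cards1 e) rank_le_card.
case: (posnP (rank M [set e])) => [r0|rpos].
  have : rank Mt X <= rank Mt (S e) by apply: rank_mono.
  by rewrite rS r0 muln0; lia.
(* Now [e] is a coloop: [~: S e] falls short of full rank by at least [t], and restoring [S e :\: X]
   regains at most [t - #|X|]. *)
have : rank Mt (~: X) <= rank Mt (~: S e) + #|S e :\: X|.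
  apply: leq_trans (rankU_le _ _ _); apply: rank_mono; apply/subsetP => x.
  by rewrite !inE => ->; case: (x \in S e).
rewrite cardsD (setIidPr sX) S_card.
move: lS; rewrite rS; have -> : rank M [set e] = 1 by lia.
have := rank_le_card Mt X; lia.
Qed.

End Expansion.

Lemma lambdaC (T : finType) (M : matroid T) X : lambda M (~: X) = lambda M X.
Proof. by rewrite /lambda setCK addnC. Qed.

(** * Splitting a leaf of a tree *)

Section SplitLeaf.
Variables (V : finType) (adj : rel V) (v : V).
Hypotheses (tree : is_tree adj) (leaf_v : leaf adj v).

(** Two pendant neighbours are attached at once, so the degree of the leaf [v] jumps from one to
    three. *)
Definition split_adj : rel (V + bool) := fun x y =>
  match x, y with
  | inl a, inl b => adj a b
  | inl a, inr _ => a == v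
  | inr _, inl b => b == v
  | inr _, inr _ => false
  end.

(** Contraction of the two new edges. *)
Definition split_proj (x : V + bool) : V := if x is inl a then a else v.

Let adj_sym : symmetric adj. Proof. by case: tree. Qed.

Lemma split_adj_sym : symmetric split_adj.
Proof. by case=> [a|b] [c|d] //=; apply: adj_sym. Qed.

Lemma connect_inl (e : rel V) (e' : rel (V + bool)) :
  (forall a b, e a b -> e' (inl a) (inl b)) ->
  forall a b, connect e a b -> connect e' (inl a) (inl b).
Proof.
move=> h a b /connectP[p]; elim: p a => [|c p IH] a /=.
  by move=> _ ->; apply: connect0.
move=> /andP[ac cp] lb; apply: connect_trans (IH c cp lb).
exact/connect1/h.
Qed.

Lemma connect_split_proj (e : rel V) (e' : rel (V + bool)) :
  (forall x y, e' x y -> connect e (split_proj x) (split_proj y)) ->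
  forall x y, connect e' x y -> connect e (split_proj x) (split_proj y).
Proof.
move=> h x y /connectP[p]; elim: p x => [|c p IH] x /=.
  by move=> _ ->; apply: connect0.
by move=> /andP[/h xc cp] ly; apply: connect_trans xc (IH c cp ly).
Qed.

Lemma split_tree : is_tree split_adj.
Proof.
have [_ irr V0 conn acyc] := tree.
split; first exact: split_adj_sym.
- by case=> [a|b] /=.
- by apply/card_gt0P; exists (inl v).
- have to_v x : connect split_adj (inl v) x.
    case: x => [a|b]; last by apply: connect1; rewrite /= eqxx.
    exact: (@connect_inl adj).
  move=> x y; apply: connect_trans (to_v y).
  by rewrite (sym_connect_sym split_adj_sym).
move=> c /andP[cyc uc]; rewrite leqNgt; apply/negP => sc.
(* On a cycle of length at least three, a new vertex would have two distinct neighbours, yet its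
   only neighbour is [v]. A cycle avoiding the new vertices lives in the old tree. *)
case: (boolP (has (fun x : V + bool => if x is inr _ then true else false) c)) => [/hasP[[//|b] bc _]|nb].
  have [i c' Ec] := rot_to bc.
  have cyc' : cycle split_adj (inr b :: c') by rewrite -Ec rot_cycle.
  have uc' : uniq (inr b :: c') by rewrite -Ec rot_uniq.
  have sc' : 2 < size (inr b :: c') by rewrite -Ec size_rot.
  case: c' cyc' uc' sc' {Ec} => [|x c'] //=.
  case/lastP: c' => [|c' y] //= /andP[mx]; rewrite -cats1 -cats1 -catA cat_path.
  rewrite /= => /and3P[_ _ /andP[ym _]].
  rewrite !inE !mem_cat !inE => /andP[_ /andP[xny _]] _.
  case: x mx xny => [x|//] /eqP -> xny; case: y ym xny => [y|//] /eqP ->.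
  by rewrite eqxx orbT.
have Ec : c = map inl (map split_proj c).
  elim: c nb {cyc uc sc} => [|[a|b] c IH] //= nb.
  by rewrite -IH.
move: cyc uc sc; rewrite Ec size_map => cyc uc sc.
have : size (map split_proj c) <= 2; last by lia.
apply: acyc; rewrite /ucycle; apply/andP; split; last first.
  by move: uc; rewrite map_inj_uniq // => a b [].
by move: cyc; rewrite cycle_map.
Qed.

Lemma degree_split_inr b : degree split_adj (inr b) = 1.
Proof.
apply/eqP/cards1P; exists (inl v); apply/setP => -[a|c]; rewrite !inE //=.
Qed.

Lemma degree_split_inl a :
  degree split_adj (inl a) = degree adj a + (a == v).*2.
Proof.
rewrite /degree.
have -> : [set w | split_adj (inl a) w] =
    [set inl w | w in [set w | adj a w]] :|: [set inr b | b in [set b : bool | a == v]].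
  apply/setP=> -[w|b]; rewrite !inE /=.
    apply/idP/orP => [aw|[|]]; last by case/imsetP.
      by left; apply: imset_f; rewrite inE.
    by case/imsetP=> x; rewrite inE => ax [->].
  apply/idP/orP => [av|[|]]; first by right; apply: imset_f; rewrite inE.
    by case/imsetP.
  by case/imsetP=> x; rewrite inE.
rewrite cardsU !card_imset; try by move=> x y [].
rewrite [X in _ - X](_ : _ = 0) ?subn0; last first.
  apply/eqP; rewrite cards_eq0; apply/eqP/setP=> x; rewrite !inE.
  by apply/negP => /andP[/imsetP[y _ ->] /imsetP[]].
congr (_ + _); case: (a == v) => /=.
  by rewrite -(@eq_card _ predT) ?card_bool // => b; rewrite !inE.
by apply: eq_card0 => b; rewrite !inE.
Qed.

Lemma split_cubic :
  (forall a, ~~ leaf adj a -> degree adj a = 3) ->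
  forall x, ~~ leaf split_adj x -> degree split_adj x = 3.
Proof.
move=> cub [a|b]; rewrite /leaf ?degree_split_inr // degree_split_inl.
case: (eqVneq a v) => [->|_]; first by rewrite (eqP leaf_v).
by rewrite addn0; apply: cub.
Qed.

Lemma leaf_split_inl a : leaf adj a -> a != v -> leaf split_adj (inl a).
Proof. by rewrite /leaf degree_split_inl => /eqP -> /negPf ->. Qed.

(** Deleting an old edge keeps both new edges, so the new leaves stay on the side of [v], and
    contraction preserves the two sides. *)
Lemma connect_del_split u w x :
  connect (del_edge split_adj (inl u) (inl w)) (inl u) x =
  connect (del_edge adj u w) u (split_proj x).
Proof.
apply/idP/idP => [|h].
  move/(@connect_split_proj (del_edge adj u w)); apply=> -[a|b] [c|d] //=.
  - by move=> ac; apply: connect1.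
  - by case/andP=> /eqP-> _; apply: connect0.
  - by case/andP=> /eqP-> _; apply: connect0.
have {h} : connect (del_edge split_adj (inl u) (inl w)) (inl u) (inl (split_proj x)).
  exact: connect_inl h.
case: x => [//|b] /= h; apply: connect_trans h _; apply: connect1.
by rewrite /del_edge /= !xpair_eqE eqxx !andbF.
Qed.

Lemma connect_del_inr b x :
  connect (del_edge split_adj (inr b) (inl v)) (inr b) x = (x == inr b).
Proof.
apply/idP/eqP => [/connectP[[|y p] /=]|->]; [by move=> _ ->| |exact: connect0].
by case: y => [a|//] /andP[/and3P[/eqP ->]]; rewrite eqxx.
Qed.

Lemma connect_del_inl b x :
  connect (del_edge split_adj (inl v) (inr b)) (inl v) x = (x != inr b).
Proof.
apply/idP/idP => [/connectP[p]|].
  (* The start is generalised to any vertex other than [inr b]: the deleted edge was the only way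
     into [inr b], so this property passes along the path. *)
  have : (inl v : V + bool) != inr b by [].
  set e := del_edge _ _ _; elim: p (inl v : V + bool) => [|y p IH] z nz /=; first by move=> _ ->.
  case/andP=> zy py ex; apply: (IH y) => //; apply: contraTneq zy => ->.
  case: z nz => [a|//] _; apply/negP => /and3P[/eqP ->].
  by rewrite eqxx.
case: x => [a|c] nx; last first.
  apply: connect1; rewrite /del_edge /= !xpair_eqE !eqxx /= andbT.
  exact: nx.
apply: (@connect_inl adj); last by case: tree => _ _ _ conn _; apply: conn.
by move=> x y xy; apply/and3P; split; rewrite ?xpair_eqE ?negb_and ?orbT.
Qed.

End SplitLeaf.

(* A leaf carrying several labels is split into two new leaves, one of which
   takes exactly one of these labels, until the labelling is injective. *)
Lemma injective_relabelling (T : finType) (P : {set T} -> Prop)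
    (V : finType) (adj : rel V) (f : T -> V) :
  (forall X, P X -> P (~: X)) ->
  is_tree adj ->
  (forall a, ~~ leaf adj a -> degree adj a = 3) ->
  (forall x, leaf adj (f x)) ->
  (forall u w, adj u w -> P [set x | connect (del_edge adj u w) u (f x)]) ->
  (forall x (X : {set T}), (forall y, y \in X -> f y = f x) -> P X) ->
  exists D : branch_decomposition T,
    forall u w, @bd_adj T D u w -> P (displayed u w).
Proof.
move=> PC.
(* Induction on the number of ordered pairs sharing a leaf, diagonal included; each split separates
   at least the pair [(x0, y0)]. *)
have [n] := ubnP #|[set p : T * T | f p.1 == f p.2]|.
elim: n V adj f => // n IH V adj f lt_n tree cub lf Pe Pf.
case: (boolP (injectiveb f)) => [/injectiveP inj|/injectivePn[x0 [y0 nxy fxy]]].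
  by exists (BranchDecomposition tree cub inj lf).
pose v := f x0; have leaf_v : leaf adj v := lf x0.
(* The leaf [inr true] takes [x0] alone, [inr false] takes the other labels of [v], and [v] keeps
   none. *)
pose g x : V + bool := if f x == v then inr (x == x0) else inl (f x).
have gf x : split_proj v (g x) = f x by rewrite /g; case: eqP.
have gb b (X : {set T}) : (forall y, y \in X -> g y = inr b) -> P X.
  by move=> h; apply: (Pf x0) => y /h; rewrite -gf => ->.
(* A new edge displays a fibre of [g] at a new leaf, or its complement; that fibre lies in a single
   fibre of [f]. *)
have Pr b : P [set x | g x == inr b].
  by apply: (gb b) => y; rewrite inE => /eqP.
apply: (IH _ (split_adj adj v) g).
- move: lt_n; rewrite ltnS; apply: leq_trans; apply: proper_card; apply/properP.
  split; first by apply/subsetP=> p; rewrite !inE => /eqP gp; rewrite -!gf gp.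
  exists (x0, y0); rewrite !inE /= ?fxy // /g /v -fxy !eqxx.
  by apply: contra nxy => /eqP[] /esym/eqP ->.
- exact: split_tree.
- exact: split_cubic.
- move=> x; rewrite /g; case: eqP => [_|/eqP ne].
    by rewrite /leaf degree_split_inr.
  exact: leaf_split_inl.
- case=> [u|b] [w|c] //=.
  + move=> uw; have := Pe u w uw; congr P; apply/setP => x.
    by rewrite !inE connect_del_split gf.
  + move=> /eqP ->; have := PC _ (Pr c); congr P; apply/setP => x.
    by rewrite !inE connect_del_inl.
  + move=> /eqP ->; have := Pr b; congr P; apply/setP => x.
    by rewrite !inE connect_del_inr.
- by move=> x X h; apply: (Pf x) => y /h e; rewrite -!gf e.
Qed.

(** * The bound on the branch-width *)

Lemma leq_lambda_displayed (T : finType) (M : matroid T)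
    (D : branch_decomposition T) (u w : bd_vertex D) :
  bd_adj u w -> lambda M (displayed u w) + 1 <= bd_width M D.
Proof.
exact: (@leq_bigmax_cond _ (fun p : bd_vertex D * bd_vertex D => bd_adj p.1 p.2)
  (fun p => lambda M (displayed p.1 p.2) + 1) (u, w)).
Qed.

Lemma leq_lambda1 (T : finType) (M : matroid T) (D : branch_decomposition T) e :
  lambda M [set e] + 1 <= bd_width M D.
Proof.
have /cards1P[w Ew] := bd_label_leaf D e.
have adjE z : bd_adj (bd_label D e) z = (z == w) by rewrite -in_set1 -Ew inE.
have := @leq_lambda_displayed _ M D (bd_label D e) w; rewrite adjE eqxx.
(* The edge at a leaf isolates it: a nontrivial path from the leaf would have to start with the
   deleted edge. *)
suff -> : displayed (bd_label D e) w = [set e] by apply.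
apply/setP=> f; rewrite !inE; apply/idP/eqP => [|->]; last exact: connect0.
case/connectP=> -[_ /bd_label_inj //|z p /= /andP[/and3P[]]].
by rewrite adjE => /eqP ->; rewrite eqxx.
Qed.

Theorem theorem6p1 (T T' : finType) (M : matroid T) (t : nat)
    (S : T -> {set T'}) (Mt : matroid T') (hMt : is_expansion t S M Mt) :
  bw Mt <= t * (bw M - 1) + 1.
Proof.
rewrite {2}/bw; case: ex_minnP => k /asboolP[D <-] _ {k}.
(* [h] sends an element of the expansion to the [e] whose set [S e] contains it, so
   [bd_label D \o h] puts all of [S e] on one leaf. *)
have [h hS] := choice (blowup_cover (exp_cover hMt)).
pose P X := lambda Mt X <= t * (bd_width M D - 1).
have [] := @injective_relabelling T' P _ (@bd_adj _ D) (bd_label D \o h).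
- by move=> X; rewrite /P lambdaC.
- exact: bd_tree.
- exact: bd_cubic.
- by move=> x; apply: bd_label_leaf.
- move=> u w uw; rewrite /P.
  have -> : [set x | connect (del_edge (@bd_adj _ D) u w) u ((bd_label D \o h) x)]
      = blowup S (displayed u w).
    by apply/setP=> x; rewrite (mem_blowup (exp_disj hMt) _ (hS x)) !inE.
  rewrite (lambda_blowup hMt) leq_mul2l; apply/orP; right.
  by have := leq_lambda_displayed M uw; lia.
- move=> x X fX; rewrite /P.
  apply: (@leq_trans (t * lambda M [set h x])).
    (* As [bd_label D] is injective, elements sharing a leaf lie in the same [S (h x)]. *)
    apply: (lambda_sub_fiber hMt); apply/subsetP => y /fX /bd_label_inj <-.
    exact: hS.
  by rewrite leq_mul2l; have := leq_lambda1 M D (h x); lia.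
move=> D' PD'; rewrite /bw; case: ex_minnP => k _ /(_ (bd_width Mt D')) le_k.
apply: leq_trans (le_k _) _; first by apply/asboolP; exists D'.
by apply/bigmax_leqP => -[u w] /= /PD'; rewrite /P leq_add2r.
Qed.
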